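(* There exists a finite-dimensional commutative local $\mathbb{Q}$-algebra $R$ which is not Gorenstein and which satisfies $\operatorname{Ext}_R^1(D(R),R)=0$, where $D(R)=\operatorname{Hom}_{\mathbb{Q}}(R,\mathbb{Q})$.
   Context: For a finite-dimensional commutative algebra $R$ over a field $K$, $D(R)=\operatorname{Hom}_K(R,K)$ denotes the $K$-linear dual of $R$, regarded as an $R$-module via $(r\cdot f)(s)=f(rs)$. A commutative Artinian local ring is Gorenstein if and only if it is self-injective, i.e. injective as a module over itself. *)

(* Defs.v *)
From HB Require Import structures.
From mathcomp Require Import all_boot all_order all_algebra.

Set Implicit Arguments.
Unset Strict Implicit.
Unset Printing Implicit Defensive.

Import GRing.Theory.

Local Open Scope ring_scope.

#[short(type="comFDAlgType")]
HB.structure Definition ComFDAlgebra (K : fieldType) :=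
  {A of GRing.ComAlgebra K A & Vector K A}.

Section LocalRing.
Variable R : comNzRingType.

(* MathComp's [idealr_closed] already requires the ideal to be proper. *)
Definition maximal_ideal (m : {pred R}) : Prop :=
  idealr_closed m /\
  forall I : {pred R}, idealr_closed I -> {subset m <= I} -> I =i m.

Definition local_ring : Prop :=
  exists m : {pred R}, maximal_ideal m /\
    forall m' : {pred R}, maximal_ideal m' -> m' =i m.

End LocalRing.

Section Modules.
Variable R : comNzRingType.

Definition surjective (A B : Type) (f : A -> B) : Prop :=
  forall y, exists x, f x = y.

Definition exact_at (A B C : lmodType R)
    (f : {linear A -> B}) (g : {linear B -> C}) : Prop :=
  forall y, g y = 0 <-> exists x, f x = y.

Definition projective_module (P : lmodType R) : Prop :=
  forall (A B : lmodType R) (g : {linear A -> B}) (f : {linear P -> B}),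
    surjective g -> exists h : {linear P -> A}, forall x, g (h x) = f x.

Definition injective_module (E : lmodType R) : Prop :=
  forall (A B : lmodType R) (i : {linear A -> B}) (f : {linear A -> E}),
    injective i -> exists h : {linear B -> E}, forall x, h (i x) = f x.

(* Unfolding the recursion and splicing the short exact sequences gives an
   injective resolution 0 -> M -> E0 -> ... -> En -> 0. *)
Fixpoint inj_dim_le (n : nat) (M : lmodType R) : Prop :=
  if n is n'.+1 then
    exists (E C : lmodType R) (i : {linear M -> E}) (p : {linear E -> C}),
      [/\ injective_module E, injective i, exact_at i p, surjective p
        & inj_dim_le n' C]
  else injective_module M.

(* For a Noetherian local ring, in particular for a local finite-dimensional
   algebra, this is the usual definition of Gorenstein; in the Artinian case
   it amounts to [injective_module R^o]. *)
Definition gorenstein : Prop := exists n, inj_dim_le n R^o.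

(* The part of a projective resolution of M that determines Ext^1(M, -). *)
Definition projective_resolution2 (P2 P1 P0 M : lmodType R)
    (d2 : {linear P2 -> P1}) (d1 : {linear P1 -> P0})
    (aug : {linear P0 -> M}) : Prop :=
  [/\ projective_module P0, projective_module P1 & projective_module P2] /\
  [/\ surjective aug, exact_at d1 aug & exact_at d2 d1].

(* Ext^1(M, N) is the cohomology at Hom(P1, N) of
   Hom(P0, N) -> Hom(P1, N) -> Hom(P2, N); up to isomorphism it does not
   depend on the resolution. *)
Definition Ext1_eq0 (M N : lmodType R) : Prop :=
  exists (P2 P1 P0 : lmodType R) (d2 : {linear P2 -> P1})
         (d1 : {linear P1 -> P0}) (aug : {linear P0 -> M}),
    projective_resolution2 d2 d1 aug /\
    forall phi : {linear P1 -> N}, (forall x, phi (d2 x) = 0) ->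
      exists psi : {linear P0 -> N}, forall x, phi x = psi (d1 x).

End Modules.

Section Dual.
Variables (K : fieldType) (R : comFDAlgType K).

Definition dual : Type := 'Hom(R, K^o).

HB.instance Definition _ := GRing.Zmodule.on dual.

Definition dual_scale (r : R) (f : dual) : dual :=
  linfun ((f : 'Hom(R, K^o)) \o (r \*o idfun)).

Lemma dual_scaleE (r : R) (f : dual) (s : R) :
  (dual_scale r f : 'Hom(R, K^o)) s = (f : 'Hom(R, K^o)) (r * s).
Proof. by rewrite lfunE. Qed.

Fact dual_scaleA (a b : R) (f : dual) :
  dual_scale a (dual_scale b f) = dual_scale (a * b) f.
Proof. by apply/lfunP => s; rewrite !dual_scaleE mulrA (mulrC b). Qed.

Fact dual_scale1 : left_id 1 dual_scale.
Proof. by move=> f; apply/lfunP => s; rewrite dual_scaleE mul1r. Qed.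

Fact dual_scaleDr : right_distributive dual_scale +%R.
Proof.
by move=> a f g; apply/lfunP => s; rewrite add_lfunE !dual_scaleE add_lfunE.
Qed.

Fact dual_scaleDl (f : dual) : {morph dual_scale^~ f : a b / a + b}.
Proof.
by move=> a b; apply/lfunP => s; rewrite add_lfunE !dual_scaleE mulrDl linearD.
Qed.

HB.instance Definition _ := GRing.Zmodule_isLmodule.Build R dual
  dual_scaleA dual_scale1 dual_scaleDr dual_scaleDl.

End Dual.

(* Main.v *)
Require Import Defs.
From HB Require Import structures.
From mathcomp Require Import all_boot all_order all_algebra.
From mathcomp Require Import zify.

(* Let w = D(R), generated by two elements with syzygy module Omega in R^2; then
   Ext^1(w, R) = 0 means that every R-linear map Omega -> R extends to R^2.

   Take U with basis (u_p), p in the affine plane F_3^2, V with basis X, Y, and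
   five cubics phi_0, ..., phi_4 in the divided power algebra of U^*.  The form
   Phi = sum_k phi_k xi^(4-k) eta^k contracts to F = (phi_0, ..., phi_3) and
   G = (phi_1, ..., phi_4), and R is the algebra on U (x) V with inverse system
   <F, G>; it has Hilbert function 1, 18, 27, 2.  As u_p X G = u_p Y F, the nine
   pairs (u_p X, u_p Y) are syzygies.  That they generate all of them, and the
   extension property, both follow once the 45 first derivatives of the phi_k
   form a basis of the 45-dimensional space of quadrics.  The geometry of the
   plane achieves this: phi_0 is the sum of the cubes and phi_1, ..., phi_4 are
   the sums of the lines in each of the four parallel classes; since two points
   lie on exactly one line, each quadratic monomial occurs exactly once as a
   derivative.  R then has a monomial basis.

   R is not Gorenstein because its socle is two-dimensional: in a module of
   finite injective dimension every socle element is divisible by a fixed socle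
   monomial of R.  This holds for injective modules and descends along
   0 -> M -> E -> C -> 0 by devissage. *)

Set Implicit Arguments.
Unset Strict Implicit.
Unset Printing Implicit Defensive.

Import GRing.Theory.

Local Open Scope ring_scope.

(** * The affine plane over F_3 and the monomial basis indexed by it *)

Definition plane : Type := 'F_3 * 'F_3.
HB.instance Definition _ := Finite.on plane.
HB.instance Definition _ := GRing.Zmodule.on plane.

(* The parallel class of the line through two points differing by [d], and 0 for
   equal points. *)
Definition slope (d : plane) : nat :=
  if d.1 == 0 then (if d.2 == 0 then 0 else 1)
  else if d.2 == 0 then 2 else if d.1 == d.2 then 3 else 4.

(** [slope] determines a vector up to sign; one of the two opposite directions is chosen in each
    class. *)
Definition slope_rep (k : nat) : plane :=
  nth 0 [:: 0; (0, 1); (1, 0); (1, 1); (1, -1)] k.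

Lemma slopeN d : slope (- d) = slope d.
Proof. by rewrite /slope /= !oppr_eq0 eqr_opp. Qed.

Lemma slope_repK k : (k <= 4)%N -> slope (slope_rep k) = k.
Proof. by case: k => [|[|[|[|[|//]]]]]. Qed.

Lemma slope_le4 d : (slope d <= 4)%N.
Proof. by rewrite /slope; case: ifP; case: ifP => //; case: ifP. Qed.

Lemma plane_mul3 (d : plane) : d + d + d = 0.
Proof.
have F3 (x : 'F_3) : x + x + x = 0 by apply/val_inj; case: x => [[|[|[]]]].
by apply: injective_projections; rewrite /= F3.
Qed.

(* [X p s] is u_p X or u_p Y, for s = false or true.  An element of degree 2 is
   determined by a triple of linear forms: u_p u_q X^(2-j) Y^j contracts
   phi_j, phi_(j+1), phi_(j+2), and [E w m] is u_w in position m of the triple.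
   [G false] and [G true] are dual to F and G. *)
Inductive monomial :=
  One | X of plane & bool | E of plane & 'I_3 | G of bool.

Definition monomial_code : Type := option (plane * bool + plane * 'I_3 + bool).
Definition encode b : monomial_code :=
  match b with
  | One => None
  | X p s => Some (inl (inl (p, s)))
  | E p m => Some (inl (inr (p, m)))
  | G l => Some (inr l)
  end.
Definition decode (c : monomial_code) :=
  match c with
  | None => One
  | Some (inl (inl (p, s))) => X p s
  | Some (inl (inr (p, m))) => E p m
  | Some (inr l) => G l
  end.
Lemma encodeK : cancel encode decode. Proof. by case. Qed.
HB.instance Definition _ := Finite.copy monomial (can_type encodeK).

(** Structure constants. Contraction by u_p u_q kills phi_k unless k is the class of the line
    through p and q, where it leaves u at the third point -(p + q); this must sit in position k - s
    - t. A further [X _ s] reads position s for F and s + 1 for G. Hence a product of monomials is a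
    monomial or 0. *)
Definition sc (a b d : monomial) : bool :=
  match a, b, d with
  | One, _, _ => b == d
  | _, One, _ => a == d
  | X p s, X q t, E w m => (p + q + w == 0) && (slope (p - q)%R == s + t + m)%N
  | X p s, E q m, G l | E q m, X p s, G l => (p == q) && (m == s + l :> nat)%N
  | _, _, _ => false
  end.

(** In characteristic 3, r = -(p + q) gives q - r = p + 2q = p - q. *)
Lemma slope_sym (p q r : plane) :
  p + q + r = 0 -> slope (p - q) = slope (q - r).
Proof.
move=> /eqP; rewrite addr_eq0 => /eqP pq.
have -> : r = - (p + q) by rewrite pq opprK.
by rewrite opprK -[p - q]addr0 -(plane_mul3 q) !addrA subrK addrC addrA.
Qed.

Lemma sc_sym a b d : sc a b d = sc b a d.
Proof.
by case: a b d => [|p s|p m|l] [|q t|q n|k] [|w u|w v|j] //=;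
   rewrite [q + p]addrC -[q - p]opprB slopeN [(t + s)%N]addnC.
Qed.

Definition deg (b : monomial) : nat :=
  match b with One => 0 | X _ _ => 1 | E _ _ => 2 | G _ => 3 end.

Lemma sc_deg a b d : sc a b d -> deg d = (deg a + deg b)%N.
Proof.
by case: a b d => [|p s|p m|l] [|q t|q n|k] [|w u|w v|j] //= /eqP.
Qed.

Lemma deg_eq0 b : (deg b == 0%N) = (b == One).
Proof. by case: b. Qed.

Lemma deg_le3 b : (deg b <= 3)%N.
Proof. by case: b. Qed.

(** * Sums over the basis and coefficients of products *)

Section Sums.
Variables (K : fieldType) (T : finType).

Lemma sum_only1 (F : T -> K) x :
  (forall y, y != x -> F y = 0) -> \sum_y F y = F x.
Proof. by move=> F0; rewrite (bigD1 x) //= big1 ?addr0. Qed.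

Lemma sum_only2 (F : T -> K) x y : x != y ->
  (forall z, z != x -> z != y -> F z = 0) -> \sum_z F z = F x + F y.
Proof.
move=> xy F0; rewrite (bigD1 x) //= (bigD1 y) 1?eq_sym //= big1 ?addr0 //.
by move=> z /andP[]; apply: F0.
Qed.

Lemma sum_delta (F : T -> K) x : \sum_y (x == y)%:R * F y = F x.
Proof.
rewrite (@sum_only1 _ x) ?eqxx ?mul1r // => y.
by rewrite eq_sym => /negPf->; rewrite mul0r.
Qed.
End Sums.

Section Quotients.
Variables (K : fieldType) (F : monomial -> K).
(** The coefficient at d of the product of the monomial b with the element whose coefficients are
    F. *)
Local Notation quot b d := (\sum_c (sc b c d)%:R * F c).

Lemma quot_One d : quot One d = F d.
Proof.
rewrite (@sum_only1 _ _ _ d) /= ?eqxx ?mul1r // => y.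
by move=> /negPf->; rewrite mul0r.
Qed.

Lemma quot_XX p s q t : quot (X p s) (X q t) = (X p s == X q t)%:R * F One.
Proof.
rewrite (@sum_only1 _ _ _ One) //.
by case=> [|r u|r m|l] //= _; rewrite mul0r.
Qed.

Lemma X_neq q : X q false != X q true.
Proof. by apply/eqP. Qed.

(** The other factor sits at the third point of the line through p and w; only its bit is free,
    hence two terms. *)
Lemma quot_XE p s w m : quot (X p s) (E w m) =
  (slope (w - p)%R == s + m)%N%:R * F (X (- (p + w)) false) +
  (slope (w - p)%R == s + m + 1)%N%:R * F (X (- (p + w)) true).
Proof.
have slE : slope (p - - (p + w)) = slope (w - p).
  have e0 : - (p + w) + p + w = 0 by rewrite -addrA addNr.
  by rewrite -slopeN opprB (slope_sym e0) -slopeN opprB.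
rewrite (sum_only2 (X_neq (- (p + w)))) /=.
  rewrite slE !addn0 addrAC subrr eqxx /=.
  by rewrite [(s + 1 + m)%N]addnAC.
case=> [|q t|q n|l] //=; rewrite ?mul0r //.
case: (p + q + w =P 0) => [pqw|_] /=; last by rewrite mul0r.
have -> : q = - (p + w) by apply/eqP; rewrite -addr_eq0 addrCA addrA pqw.
by case: t; rewrite ?eqxx.
Qed.

Lemma inord_add (s l : bool) : (inord (s + l) : 'I_3) = (s + l)%N :> nat.
Proof. by rewrite inordK //; case: s; case: l. Qed.

Lemma quot_XG p s l : quot (X p s) (G l) = F (E p (inord (s + l))).
Proof.
rewrite (@sum_only1 _ _ _ (E p (inord (s + l)))) /=.
  by rewrite inord_add !eqxx mul1r.
case=> [|q t|q n|k] //=; rewrite ?mul0r //.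
case: (p =P q) => [<-|_] /=; last by rewrite mul0r.
case: (n =P _ :> nat) => [nE|_] /=; last by rewrite mul0r.
by case/eqP; congr (E _ _); apply/val_inj; rewrite /= inord_add.
Qed.

Lemma quot_EG q (m : 'I_3) l : quot (E q m) (G l) =
  (m == l :> nat)%:R * F (X q false) + (m == l.+1 :> nat)%:R * F (X q true).
Proof.
rewrite (sum_only2 (X_neq q)) /=.
  by rewrite eqxx.
case=> [|p t|p n|k] //=; rewrite ?mul0r //.
case: (p =P q) => [->|_] /=; last by rewrite mul0r.
by case: t; rewrite ?eqxx.
Qed.

Lemma quot_low b d : (deg d < deg b)%N -> quot b d = 0.
Proof.
move=> lt_db; rewrite big1 // => c _.
by case: (boolP (sc b c d)) => [/sc_deg|]; rewrite ?mul0r //; lia.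
Qed.

Lemma quot_same b d : deg d = deg b -> quot b d = (b == d)%:R * F One.
Proof.
move=> dd; rewrite (@sum_only1 _ _ _ One).
  by case: b dd => // l; case: d.
move=> c; rewrite -deg_eq0 => dc.
by case: (boolP (sc b c d)) => [/sc_deg|]; rewrite ?mul0r //; lia.
Qed.

End Quotients.

(** Once units and degrees are dealt with, only three factors [X] with product in degree 3 remain.
    Both sides then require p + q + r = 0 and equate the class of this line with s + t + u + l;
    [slope_sym] identifies the two classes. *)
Lemma sc_assoc (K : fieldType) a b c d :
  \sum_e (sc a b e)%:R * (sc e c d)%:R =
  \sum_e (sc b c e)%:R * (sc a e d)%:R :> K.
Proof.
have scl F x : \sum_e (sc One x e)%:R * F e = F x :> K by apply: sum_delta.
have scr F x : \sum_e F e * (sc One e x)%:R = F x :> K.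
  under eq_bigr => e _ do rewrite mulrC /= eq_sym.
  exact: sum_delta.
have [->|a1] := eqVneq a One; first by rewrite scl scr.
have [->|b1] := eqVneq b One.
  by rewrite scl; under eq_bigr => e _ do rewrite sc_sym; rewrite scl.
have [->|c1] := eqVneq c One.
  under eq_bigr => e _ do rewrite (sc_sym e); rewrite scr.
  by under eq_bigr => e _ do rewrite (sc_sym b); rewrite scl.
have [dE|dN] := eqVneq (deg d) (deg a + deg b + deg c)%N; last first.
  rewrite !big1 // => e _.
    have [/sc_deg eE|_] := boolP (sc b c e); last by rewrite mul0r.
    have [/sc_deg dE|_] := boolP (sc a e d); last by rewrite mulr0.
    by case/eqP: dN; rewrite dE eE addnA.
  have [/sc_deg eE|_] := boolP (sc a b e); last by rewrite mul0r.
  have [/sc_deg dE|_] := boolP (sc e c d); last by rewrite mulr0.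
  by case/eqP: dN; rewrite dE eE.
case: a a1 dE => // [p s|p m|l] _; case: b b1 => // [q t|q n|k] _;
  case: c c1 => // [r u|r v|j] _; case: d => // l _.
under eq_bigr => e _ do rewrite mulrC (sc_sym e).
under [RHS]eq_bigr => e _ do rewrite mulrC.
rewrite !quot_XG /= !inord_add.
rewrite [q + r + p]addrC addrA; case: (p + q + r =P 0) => //= pqr.
by rewrite (slope_sym pqr); congr (_ == _)%:R; lia.
Qed.

(** * The commutative algebra on the monomial basis *)

Definition alg (K : fieldType) : Type := {ffun monomial -> K}.
HB.instance Definition _ (K : fieldType) :=
  Vector.copy (alg K) {ffun monomial -> K^o}.

(* Without the locks, failing unifications unfold products of basis elements. *)
HB.lock Definition mon (K : fieldType) (b : monomial) : alg K :=
  [ffun d => (b == d)%:R].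

HB.lock Definition alg_mul (K : fieldType) (f g : alg K) : alg K :=
  [ffun d => \sum_a \sum_b (sc a b d)%:R * (f a * g b)].

Section Algebra.
Variable K : fieldType.
Local Notation mon := (mon K).
Local Notation alg_mul := (@alg_mul K).
Implicit Types f g h : alg K.

Lemma monE b d : mon b d = (b == d)%:R.
Proof. by rewrite unlock ffunE. Qed.

Fact alg_mulE f g d :
  alg_mul f g d = \sum_a \sum_b (sc a b d)%:R * (f a * g b).
Proof. by rewrite unlock ffunE. Qed.

Fact alg_mulC : commutative alg_mul.
Proof.
move=> f g; apply/ffunP => d; rewrite !alg_mulE exchange_big /=.
by apply: eq_bigr => a _; apply: eq_bigr => b _; rewrite sc_sym (mulrC (f _)).
Qed.

Fact alg_mulA : associative alg_mul.
Proof.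
move=> f g h; apply/ffunP => d; rewrite !alg_mulE.
transitivity (\sum_a \sum_b \sum_c
    (\sum_e (sc b c e)%:R * (sc a e d)%:R) * (f a * (g b * h c))).
  apply: eq_bigr => a _; under eq_bigr => e _ do rewrite alg_mulE.
  under eq_bigr => e _ do (rewrite mulr_sumr mulr_sumr).
  rewrite exchange_big /=; apply: eq_bigr => b _.
  under eq_bigr => e _ do (rewrite mulr_sumr mulr_sumr).
  rewrite exchange_big /=; apply: eq_bigr => c _.
  rewrite mulr_suml; apply: eq_bigr => e _.
  by rewrite (mulrCA (f a)) (mulrCA (sc a e d)%:R) !mulrA.
under eq_bigr => a _ do under eq_bigr => b _ do under eq_bigr => c _ do
  rewrite -sc_assoc.
symmetry; transitivity (\sum_e \sum_c \sum_a \sum_b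
    (sc a b e)%:R * (sc e c d)%:R * (f a * (g b * h c))).
  apply: eq_bigr => e _; apply: eq_bigr => c _; rewrite alg_mulE.
  rewrite mulr_suml mulr_sumr; apply: eq_bigr => a _.
  rewrite mulr_suml mulr_sumr; apply: eq_bigr => b _.
  by rewrite -!mulrA mulrCA.
under [LHS] eq_bigr => e _ do rewrite exchange_big /=.
rewrite exchange_big /=; apply: eq_bigr => a _.
under [LHS] eq_bigr => e _ do rewrite exchange_big /=.
rewrite exchange_big /=; apply: eq_bigr => b _.
rewrite exchange_big /=; apply: eq_bigr => c _.
by rewrite mulr_suml.
Qed.

Fact alg_mul_mon b f d : alg_mul (mon b) f d = \sum_c (sc b c d)%:R * f c.
Proof.
rewrite alg_mulE (@sum_only1 _ _ _ b).
  by apply: eq_bigr => c _; rewrite monE eqxx mul1r.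
move=> a; rewrite eq_sym => /negPf ab; rewrite big1 // => c _.
by rewrite monE ab mul0r mulr0.
Qed.

Fact alg_mul1 : left_id (mon One) alg_mul.
Proof. by move=> f; apply/ffunP => d; rewrite alg_mul_mon quot_One. Qed.

Fact alg_mulDl : left_distributive alg_mul +%R.
Proof.
move=> f g h; apply/ffunP => d; rewrite ffunE !alg_mulE -big_split.
apply: eq_bigr => a _ /=.
by rewrite -big_split; apply: eq_bigr => b _; rewrite ffunE mulrDl mulrDr.
Qed.

Fact alg_one_neq0 : mon One != 0.
Proof.
by apply/eqP => /ffunP/(_ One)/eqP; rewrite monE ffunE eqxx oner_eq0.
Qed.

HB.instance Definition _ := GRing.Zmodule_isComNzRing.Build (alg K)
  alg_mulA alg_mulC alg_mul1 alg_mulDl alg_one_neq0.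

Fact alg_scaleAl (k : K) f g : k *: (f * g) = (k *: f) * g.
Proof.
apply/ffunP => d; rewrite ffunE !alg_mulE scaler_sumr; apply: eq_bigr => a _.
rewrite scaler_sumr; apply: eq_bigr => b _.
by rewrite ffunE scalerAr scalerAl.
Qed.

HB.instance Definition _ := GRing.Lmodule_isLalgebra.Build K (alg K)
  alg_scaleAl.
HB.instance Definition _ := GRing.Lalgebra_isComAlgebra.Build K (alg K).

End Algebra.

(** * Units, order of vanishing and locality *)

Section LocalAlgebra.
Variable K : fieldType.
Local Notation A := (alg K).
Local Notation mon := (mon K).
Implicit Types f g h r : A.

Lemma oneE b : (1 : A) b = (One == b)%:R.
Proof. exact: monE. Qed.

Lemma addE f g b : (f + g) b = f b + g b.
Proof. exact: ffunE. Qed.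

Lemma scaleE (k : K) f b : (k *: f) b = k * f b.
Proof. exact: ffunE. Qed.

Lemma mul_mon b f d : (mon b * f) d = \sum_c (sc b c d)%:R * f c.
Proof. exact: alg_mul_mon. Qed.

Lemma mulE f g d : (f * g) d = \sum_a \sum_b (sc a b d)%:R * (f a * g b).
Proof. exact: alg_mulE. Qed.

Lemma mon_mul_mon b c d : (mon b * mon c) d = (sc b c d)%:R.
Proof.
rewrite mul_mon (@sum_only1 _ _ _ c) ?monE ?eqxx ?mulr1 // => e.
by rewrite eq_sym monE => /negPf->; rewrite mulr0.
Qed.

Lemma alg_sum f : f = \sum_b f b *: mon b.
Proof.
apply/ffunP => d; rewrite sum_ffunE (@sum_only1 _ _ _ d) => [|b /negPf bd].
  by rewrite scaleE monE eqxx mulr1.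
by rewrite scaleE monE bd mulr0.
Qed.

Definition order_ge n f := forall b, (deg b < n)%N -> f b = 0.

Lemma order_ge_mul m n f g :
  order_ge m f -> order_ge n g -> order_ge (m + n) (f * g).
Proof.
move=> fm gn d dmn; rewrite mulE big1 // => a _; rewrite big1 // => b _.
have [/sc_deg dE|_] := boolP (sc a b d); last by rewrite mul0r.
have [am|ma] := ltnP (deg a) m; first by rewrite fm ?mul0r ?mulr0.
by rewrite [g b]gn ?mulr0 //; lia.
Qed.

Lemma order_ge_exp n f : order_ge 1 f -> order_ge n (f ^+ n).
Proof.
move=> f1; elim: n => [b //|n IHn]; rewrite exprS.
exact: (order_ge_mul f1 IHn).
Qed.

Lemma coef1_mul f g : (f * g) One = f One * g One.
Proof.
rewrite mulE (@sum_only1 _ _ _ One) => [|a].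
  rewrite (@sum_only1 _ _ _ One) ?mul1r // => b.
  by rewrite /= => /negPf->; rewrite mul0r.
rewrite -deg_eq0 => a0; rewrite big1 // => b _.
have [/sc_deg/= dE|_] := boolP (sc a b One); last by rewrite mul0r.
lia.
Qed.

(** Normalising the constant term, r = 1 - z up to a scalar with z of order at least 1; degrees stop
    at 3, so z^4 = 0 and a geometric series inverts r. *)
Lemma alg_unit r : r One != 0 -> exists s, r * s = 1.
Proof.
move=> r0; pose z : A := 1 - (r One)^-1 *: r.
have zE : 1 - z = (r One)^-1 *: r by rewrite subKr.
have z1 : order_ge 1 z.
  move=> b; rewrite ltnS leqn0 deg_eq0 => /eqP->.
  by rewrite addE -scaleN1r !scaleE oneE eqxx mulVf // mulN1r subrr.
have z4 : z ^+ 4 = 0.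
  apply/ffunP => b; rewrite (order_ge_exp z1) ?ffunE //.
  by rewrite ltnS deg_le3.
exists ((r One)^-1 *: \sum_(i < 4) z ^+ i).
have := subrX1 z 4; rewrite z4 sub0r => /(congr1 -%R).
by rewrite opprK -mulNr opprB zE -scalerAl -scalerAr.
Qed.

(** A proper ideal contains no unit, so it lies in the kernel of the constant term. *)
Lemma alg_local : local_ring A.
Proof.
pose m : {pred A} := [pred f : A | f One == 0].
have mI : idealr_closed m.
  split=> [||a u v]; rewrite !inE; first by rewrite ffunE.
    by rewrite oneE eqxx oner_eq0.
  by rewrite addE coef1_mul => /eqP-> /eqP->; rewrite mulr0 addr0.
have sub (I : {pred A}) : idealr_closed I -> {subset I <= m}.
  case=> I0 I1 IL r rI; apply: contraNT I1 => /alg_unit[s rs].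
  by rewrite -rs -[_ * _]addr0 mulrC IL.
have mM : maximal_ideal m.
  by split=> // I II mI' f; apply/idP/idP => [/sub|/mI']; first apply.
exists m; split=> // m' [m'I m'M] f.
by rewrite -(m'M m mI) //; apply: sub.
Qed.

End LocalAlgebra.

(** * Submodules, socles and finite injective dimension *)

Section Submodule.
Variables (R : pzRingType) (V : lmodType R) (S : {pred V}).

Record submodule (SP : submod_closed S) :=
  Submodule { submodule_val : V; _ : submodule_val \in S }.

Variable SP : submod_closed S.
HB.instance Definition _ := [isSub for @submodule_val SP].
HB.instance Definition _ := [Choice of submodule SP by <:].
HB.instance Definition _ := GRing.SubChoice_isSubLmodule.Build R V S
  (submodule SP) SP.
End Submodule.

Section NotGorenstein.
Variable K : fieldType.
Local Notation A := (alg K).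
Local Notation mon := (mon K).

Definition socle_elt (M : lmodType A) (x : M) :=
  forall a, a != One -> mon a *: x = 0.

Lemma socle_scale (M : lmodType A) (x : M) (r : A) :
  socle_elt x -> r *: x = (r One)%:A *: x.
Proof.
move=> x0; rewrite {1}[r]alg_sum scaler_suml (bigD1 One) //= big1 ?addr0 //.
by move=> a a1; rewrite -mulr_algl -scalerA x0 ?scaler0.
Qed.

Definition ideal_basis (S : {set monomial}) :=
  forall a c d, c \in S -> sc a c d -> d \in S.

(** The monomial b is a minimal generator of the ideal J spanned by S, so u -> u(b) x is linear on J
    for x in the socle. Injectivity extends this map to A, and y is the image of 1. *)
Lemma injective_extend (M : lmodType A) (S : {set monomial}) b (x : M) :
  injective_module M -> ideal_basis S -> b \in S ->
  (forall a c, c \in S -> a != One -> ~~ sc a c b) -> socle_elt x ->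
  exists y, mon b *: y = x /\ forall c, c \in S -> c != b -> mon c *: y = 0.
Proof.
move=> injM IS bS minb x0.
pose J : {pred A^o} := [pred f : A | [forall c, (c \notin S) ==> (f c == 0)]].
have JP (f : A) : reflect (forall c, c \notin S -> f c = 0) (f \in J).
  apply: (iffP forallP) => fS c; first by move=> cS; apply/eqP/(implyP (fS c)).
  by apply/implyP => /fS ->.
have Jsub : submod_closed J.
  split=> [|r f g /JP fS /JP gS]; first by apply/JP => c _; rewrite ffunE.
  apply/JP => c cS; rewrite addE gS // addr0 mulE big1 // => a _.
  rewrite big1 // => d _.
  have [dS|dS] := boolP (d \in S); last by rewrite fS // !mulr0.
  have [acd|_] := boolP (sc a d c); last by rewrite mul0r.
  by rewrite (IS _ _ _ dS acd) in cS.
pose f (u : submodule Jsub) : M := (\val u b)%:A *: x.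
have fL : linear f.
  move=> r u v; rewrite /f linearP addE.
  have -> : (r * val u) b = r One * val u b.
    rewrite mulE (@sum_only1 _ _ _ One) => [|a a1].
      exact: (quot_One (fun c => r One * val u c)).
    rewrite big1 // => c _.
    have [cS|cS] := boolP (c \in S); last by rewrite (JP _ (valP u)) // !mulr0.
    by rewrite (negPf (minb _ _ cS a1)) mul0r.
  have zs : socle_elt ((val u b)%:A *: x).
    by move=> a a1; rewrite scalerA mulrC -scalerA x0 ?scaler0.
  by rewrite (socle_scale _ zs) scalerA -scalerAl mul1r scalerA -!scalerDl.
pose F : {linear submodule Jsub -> M} :=
  HB.pack f (GRing.isLinear.Build _ _ _ _ f fL).
have [h hE] := injM _ _ (val : {linear submodule Jsub -> A^o}) F val_inj.
have hmon c : c \in S -> mon c *: h 1 = (mon c b)%:A *: x.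
  move=> cS; have cJ : mon c \in J.
    by apply/JP => d dS; rewrite monE; case: eqP dS cS => // -> /negPf->.
  have cE : mon c *: (1 : A^o) = \val (Submodule Jsub cJ) by exact: mulr1.
  by rewrite -linearZ cE hE.
exists (h 1); split=> [|c cS /negPf cb].
  by rewrite hmon // monE eqxx !scale1r.
by rewrite hmon // monE cb !scale0r.
Qed.

(* Lifting maps from the residue field along p suffices to lift maps from A / I
   for every monomial ideal I. *)
Lemma devissage (E C : lmodType A) (p : {linear E -> C}) :
  injective_module E ->
  (forall y, socle_elt y -> exists x, socle_elt x /\ p x = y) ->
  forall S, ideal_basis S -> forall y, (forall b, b \in S -> mon b *: y = 0) ->
  exists x, (forall b, b \in S -> mon b *: x = 0) /\ p x = y.
Proof.
move=> injE lift S; have [n] := ubnP #|~: S|.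
elim: n S => // n IHn S ltSn IS y yS.
have [b0 b0S|allS] := pickP [pred b | b \notin S]; last first.
  exists 0; split=> [b _|]; first by rewrite scaler0.
  rewrite linear0 -[y]scale1r -[1]/(mon One) yS //.
  by have := allS One; rewrite inE => /negPn.
(* Maximal degree makes [b |: S] span an ideal again and puts b y in the socle. *)
have [b bS maxb] := arg_maxnP deg b0S.
have Sdeg d : (deg b < deg d)%N -> d \in S.
  by apply: contraLR => dS; rewrite -leqNgt; apply: maxb.
have IS' : ideal_basis (b |: S).
  move=> a c d; rewrite !in_setU1 => /orP[/eqP->|cS] acd; last first.
    by rewrite (IS _ _ _ cS acd) orbT.
  have [a1|a1] := eqVneq a One.
    by move: acd; rewrite a1 /= => /eqP->; rewrite eqxx.
  by rewrite Sdeg ?orbT // (sc_deg acd); move: a1; rewrite -deg_eq0; lia.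
have minb a c : c \in b |: S -> a != One -> ~~ sc a c b.
  rewrite in_setU1 => cS a1; apply/negP => acb; case/orP: cS => [/eqP cb|cS].
    by move: a1; rewrite -deg_eq0; have := sc_deg acb; rewrite cb; lia.
  by rewrite inE (IS _ _ _ cS acb) in bS.
have by0 : socle_elt (mon b *: y).
  move=> a a1; rewrite scalerA [mon a * mon b]alg_sum.
  rewrite scaler_suml big1 // => d _.
  rewrite mon_mul_mon; have [abd|_] := boolP (sc a b d); last first.
    by rewrite !scale0r.
  rewrite scale1r yS // Sdeg // (sc_deg abd); move: a1; rewrite -deg_eq0; lia.
(* A socle lift x1 of b y has the form b x2 with x2 killed by S; then y - p x2 is killed by the
   larger ideal, and induction lifts it. *)
have [x1 [x1s px1]] := lift _ by0.
have [x2 [bx2 x2S]] := injective_extend injE IS' (setU11 b S) minb x1s.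
have [||x3 [x3S px3]] := IHn (b |: S) _ IS' (y - p x2).
- rewrite -ltnS (leq_trans _ ltSn) // ltnS proper_card // properE.
  rewrite setCS subsetUr; apply/subsetPn; exists b; first by rewrite inE.
  by rewrite inE setU11.
- move=> c; rewrite in_setU1 scalerBr -linearZ.
  have [->|cb /= cS] := eqVneq c b; first by rewrite bx2 px1 subrr.
  by rewrite yS // x2S ?in_setU1 ?cS ?orbT // linear0 subr0.
exists (x2 + x3); split=> [c cS|]; last by rewrite linearD px3 addrC subrK.
have cS' : c \in b |: S by rewrite in_setU1 cS orbT.
rewrite scalerDr x3S // addr0 x2S //.
by apply: contraNneq bS => <-.
Qed.

Definition socle_divisible (M : lmodType A) :=
  forall x : M, socle_elt x -> exists y, mon (G false) *: y = x.

Lemma ideal_basis_G : ideal_basis [set G false].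
Proof.
move=> a c d; rewrite inE => /eqP-> acd.
by case: a d acd => [|p s|p m|l] //= d /eqP<-; rewrite inE.
Qed.

Lemma injective_socle_divisible (M : lmodType A) :
  injective_module M -> socle_divisible M.
Proof.
move=> injM x x0.
have minG a c : c \in [set G false] -> a != One -> ~~ sc a c (G false).
  by rewrite inE => /eqP->; case: a.
have [y [yE _]] := injective_extend injM ideal_basis_G (set11 _) minG x0.
by exists y.
Qed.

(** Write g for [G false] and i x = g e in E. As g kills p e, devissage gives e0 with p e0 = p e and
    g e0 = 0; then e - e0 = i m and g m = x. *)
Lemma inj_dim_socle_divisible n (M : lmodType A) :
  inj_dim_le n M -> socle_divisible M.
Proof.
elim: n M => [|n IHn] M; first exact: injective_socle_divisible.
case=> [E [C [i [p [injE i_inj ip_exact p_surj /IHn divC]]]]] x x0.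
have pi z : p (i z) = 0 by apply/ip_exact; exists z.
have [|e ge] := injective_socle_divisible injE (x := i x).
  by move=> a a1; rewrite -linearZ x0 ?linear0.
(* By induction y = g c in C; if c = p z, then g z is a socle lift of y. *)
have lift y : socle_elt y -> exists z, socle_elt z /\ p z = y.
  case/divC => c <-; have [z <-] := p_surj c.
  exists (mon (G false) *: z); split; last by rewrite linearZ.
  move=> a a1; rewrite scalerA -[_ * _]/(mon a * mon (G false)).
  have -> : mon a * mon (G false) = 0.
    by apply/ffunP => d; rewrite mon_mul_mon ffunE; case: a a1.
  by rewrite scale0r.
have [|e0 [ge0 pe0]] := devissage injE lift ideal_basis_G (y := p e).
  by move=> b; rewrite inE => /eqP->; rewrite -linearZ /= ge pi.
have [m im] : exists m, i m = e - e0.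
  by apply/ip_exact; rewrite linearB pe0 subrr.
exists m; apply: i_inj; rewrite linearZ /= im scalerBr ge ge0 ?subr0 //.
by rewrite inE.
Qed.

(** The socle element [G true] is not a multiple of [G false], whose multiples are all scalar. *)
Lemma alg_not_gorenstein : ~ gorenstein A.
Proof.
case=> n /inj_dim_socle_divisible/(_ (mon (G true)))[a a1|y].
  by apply/ffunP => d; rewrite mon_mul_mon ffunE; case: a a1.
move/ffunP/(_ (G true)); rewrite mul_mon monE eqxx quot_same //= mul0r.
by move/esym/eqP; rewrite oner_eq0.
Qed.

End NotGorenstein.

(** * Free modules and generators of kernels *)

Section FreeModules.
Variables (R : comNzRingType) (I : finType).
Implicit Type M : lmodType R.
Local Notation free := {ffun I -> R^o}.

Definition free_basis (i : I) : free := [ffun j => (i == j)%:R].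

Definition free_map M (v : I -> M) (u : free) : M := \sum_i u i *: v i.

Fact free_map_linear M (v : I -> M) : linear (free_map v).
Proof.
move=> r x y; rewrite /free_map scaler_sumr -big_split.
by apply: eq_bigr => i _; rewrite !ffunE scalerDl scalerA.
Qed.
HB.instance Definition _ M (v : I -> M) :=
  GRing.isLinear.Build R free M _ (free_map v) (free_map_linear v).

Lemma free_sum (u : free) : u = \sum_i u i *: free_basis i.
Proof.
apply/ffunP => j; rewrite sum_ffunE (bigD1 j) //= big1 ?addr0 => [|i].
  by rewrite !ffunE eqxx [RHS]mulr1.
by move=> /negPf ij; rewrite !ffunE ij [LHS]mulr0.
Qed.

Lemma linear_freeE M (f : {linear free -> M}) u :
  f u = \sum_i u i *: f (free_basis i).
Proof.
by rewrite {1}[u]free_sum linear_sum; under eq_bigr do rewrite linearZ.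
Qed.

Lemma free_map_basis M (v : I -> M) i : free_map v (free_basis i) = v i.
Proof.
rewrite /free_map (bigD1 i) //= big1 ?addr0 => [|j].
  by rewrite ffunE eqxx scale1r.
by rewrite eq_sym => /negPf ij; rewrite ffunE ij scale0r.
Qed.

Lemma free_projective : projective_module free.
Proof.
move=> P Q g f g_surj.
have [a aE] := fin_all_exists (fun i => g_surj (f (free_basis i))).
exists (free_map a : {linear free -> P}) => x.
rewrite [RHS]linear_freeE /= /free_map linear_sum.
by apply: eq_bigr => i _; rewrite linearZ aE.
Qed.

End FreeModules.

(** A K-basis of the kernel generates it over R; this supplies the last module of the resolution. *)
Lemma free_kernel_presented (K : fieldType) (R : comFDAlgType K) (I J : finType)
    (d : {linear {ffun I -> R^o} -> {ffun J -> R^o}}) :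
  exists n (v : 'I_n -> {ffun I -> R^o}),
    exact_at (free_map v : {linear {ffun 'I_n -> R^o} -> {ffun I -> R^o}}) d.
Proof.
(* Dropping [^o] views d as a map of K-vector spaces. *)
pose f (u : {ffun I -> R}) : {ffun J -> R} := d u.
have algZ (L : finType) (k : K) (u : {ffun L -> R}) :
    k *: u = (k%:A : R) *: (u : {ffun L -> R^o}) :> {ffun L -> R}.
  by apply/ffunP => l; rewrite !ffunE [RHS]mulr_algl.
have fL : linear f.
  by move=> k u w; rewrite /f algZ [LHS]linearP -algZ.
pose F : {linear {ffun I -> R} -> {ffun J -> R}} :=
  HB.pack f (GRing.isLinear.Build _ _ _ _ f fL).
pose W := lker (linfun F).
have inW (u : {ffun I -> R}) : (u \in W) = (d u == 0).
  by rewrite memv_ker lfunE.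
exists (\dim W), (fun i => (vbasis W)`_i : {ffun I -> R}) => y; split.
  move=> /eqP; rewrite -inW => /coord_vbasis yE.
  exists [ffun i => (coord (vbasis W) i y)%:A].
  rewrite [RHS]yE /= /free_map; apply: eq_bigr => i _.
  by rewrite ffunE algZ.
case=> x <-; rewrite /= /free_map linear_sum big1 // => i _.
rewrite linearZ; have /eqP-> : d ((vbasis W)`_i : {ffun I -> R}) == 0.
  by rewrite -inW vbasis_mem ?mem_nth ?size_tuple.
exact: scaler0.
Qed.

(** * Presentation of the dual by nine syzygies *)

Section Presentation.
Variable K : fieldType.
Local Notation A := (alg K).
Local Notation mon := (mon K).
Local Notation P0 := {ffun bool -> A^o}.
Local Notation P1 := {ffun plane -> A^o}.

Definition coefG (l : bool) (f : A) : K^o := f (G l).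

Fact coefG_linear l : linear (coefG l).
Proof. by move=> k f g; rewrite /coefG addE scaleE. Qed.
HB.instance Definition _ l :=
  GRing.isLinear.Build K A K^o _ (coefG l) (coefG_linear l).

Definition dualG (l : bool) : dual A := linfun (coefG l).

(* The sign turns u_p X G = u_p Y F into the syzygy (u_p X, u_p Y). *)
Definition dual_cover : {linear P0 -> dual A} :=
  free_map (fun s : bool => if s then - dualG false else dualG true).

Definition dual_rel : {linear P1 -> P0} :=
  free_map (fun p => [ffun s : bool => mon (X p s) : A^o] : P0).

Lemma dual_coverE (y : P0) (r : A) :
  (dual_cover y : 'Hom(A, K^o)) r =
  (y false * r : A) (G true) - (y true * r : A) (G false).
Proof.
rewrite /dual_cover /= /free_map big_bool scalerN addrC.
rewrite add_lfunE opp_lfunE -/(dual_scale _ _) -/(dual_scale _ _).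
by rewrite !dual_scaleE !lfunE.
Qed.

Lemma dual_relE (u : P1) s d :
  (dual_rel u s : A) d = \sum_p (mon (X p s) * u p : A) d.
Proof.
rewrite /dual_rel /= /free_map !sum_ffunE.
apply: eq_bigr => p _; rewrite mulrC; congr (fun_of_fin _ d).
by rewrite !ffunE.
Qed.

Lemma dual_rel_basis p r s :
  (dual_rel (r *: free_basis A p) s : A) = r * mon (X p s).
Proof. by rewrite linearZ /= free_map_basis !ffunE. Qed.

Lemma dual_ext (h k : dual A) :
  (forall b, (h : 'Hom(A, K^o)) (mon b) = (k : 'Hom(A, K^o)) (mon b)) -> h = k.
Proof.
move=> hk; apply/lfunP => r; rewrite [r]alg_sum !linear_sum.
by apply: eq_bigr => b _; rewrite !linearZ /= hk.
Qed.

(** On a generator, both terms read the coefficient at [E p 1]. *)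
Lemma dual_cover_rel u : dual_cover (dual_rel u) = 0.
Proof.
have gen0 p : dual_cover (dual_rel (free_basis A p)) = 0.
  have relE s : (dual_rel (free_basis A p) s : A) = mon (X p s).
    by rewrite -[free_basis A p]scale1r dual_rel_basis mul1r.
  apply: dual_ext => b; rewrite dual_coverE !relE.
  rewrite [RHS]zero_lfunE; apply/eqP; rewrite subr_eq0.
  by rewrite [eqbLHS]mul_mon [eqbRHS]mul_mon !quot_XG.
rewrite [dual_rel u]linear_freeE linear_sum big1 // => p _.
rewrite linearZ -[RHS](scaler0 _ (u p)); congr (_ *: _); exact: gen0.
Qed.

Lemma dual_cover_surj : surjective dual_cover.
Proof.
move=> h.
have [H HE] : exists H : monomial -> K,
    forall b, (h : 'Hom(A, K^o)) (mon b) = H b.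
  by exists (fun b => (h : 'Hom(A, K^o)) (mon b)).
(* Coefficients of [y false] and [y true]. Values at [G false] and [E q 0] are out of reach of
   [dualG true] and come from [bc]; all others come from [ac]. *)
pose ac d := match d with
  | One => H (G true)
  | X q s => H (E q (inord (s + 1)))
  | E p m => if m == 0 then 0 else H (X p (m == 2%N :> nat))
  | G l => if l then H One else 0 end.
pose bc d := match d with
  | One => - H (G false)
  | X q s => if s then 0 else - H (E q (inord 0))
  | _ => 0 end.
pose y : P0 := [ffun s : bool => if s then finfun bc : A else finfun ac : A].
have yE s d : (y s : A) d = if s then bc d else ac d.
  by rewrite ffunE; case: s; rewrite ffunE.
exists y; apply: dual_ext => d; rewrite dual_coverE HE.
rewrite ![y _ * mon d]mulrC !mul_mon.
under eq_bigr do rewrite yE; under [X in _ - X]eq_bigr do rewrite yE.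
case: d => [|p s|p m|l].
- by rewrite !quot_One subr0.
- rewrite !quot_XG /= subr0 -val_eqE /= !inordK; last by case: s.
  by case: s.
- rewrite !quot_EG -(inord_val m) inordK //=.
  case: m => [[|[|[|//]]] mlt] /=;
  by rewrite ?mul0r ?mul1r ?mulr0 ?add0r ?addr0 ?subr0 ?opprK ?sub0r ?opprK.
- rewrite !quot_same //.
  by case: l; rewrite ?eqxx /= ?mul0r ?mul1r ?sub0r ?subr0 ?opprK.
Qed.

(** Comparing coefficients, the linear part of a syzygy is a scalar combination of the generators,
    and its coefficients at [E w m] and [G l] in component s depend only on s + m and s + l.
    Multiples of the generators realise all such families. *)
Lemma dual_cover_kernel (y : P0) : dual_cover y = 0 ->
  exists x, dual_rel x = y.
Proof.
move=> y0.
have y0E b : \sum_c (sc b c (G true))%:R * (y false : A) c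
           = \sum_c (sc b c (G false))%:R * (y true : A) c.
  apply/eqP; rewrite -subr_eq0 -!mul_mon ![mon b * _]mulrC.
  by rewrite -dual_coverE y0 zero_lfunE.
pose yc s d : K := (y s : A) d.
(* The common values for s + m = k and for s + l = k; only the largest k needs [y true]. *)
pose V w k :=
  if (k < 3)%N then yc false (E w (inord k)) else yc true (E w (inord 2)).
pose Z k := if (k < 2)%N then yc false (G (k == 1)%N) else yc true (G true).
have yOne s : yc s One = 0.
  have := y0E (G (~~ s)); rewrite !quot_same //.
  rewrite -/(yc false One) -/(yc true One).
  by case: s; rewrite /= ?mul0r ?mul1r.
have yX s p t : yc s (X p t) = (s == t)%:R * yc false (X p false).
  have yE k := y0E (E p (inord k)).
  have := yE 0%N; have := yE 1%N; have := yE 2%N.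
  rewrite !quot_EG !inordK // -!/(yc _ _) /= !mul0r !mul1r !add0r !addr0.
  by case: s; case: t => //= *; rewrite ?mul1r ?mul0r //; congruence.
have yE s p (m : 'I_3) : yc s (E p m) = V p (s + m)%N.
  rewrite /V -(inord_val m); case: s; last by rewrite inordK ?ltn_ord.
  have := y0E (X p true); have := y0E (X p false).
  rewrite !quot_XG -!/(yc _ _) /=.
  by case: m => [[|[|[|//]]] mlt]; rewrite /= ?inordK.
have yG s l : yc s (G l) = Z (s + l)%N.
  have := y0E One; rewrite !quot_One -!/(yc _ _) /Z.
  by case: s; case: l.
(* [V w k] is produced by the single generator p = w + [slope_rep k], multiplied by [X u false] at
   the third point u = -(p + w); [Z k] by generator 0 multiplied by [E 0 k]. *)
pose x : P1 := [ffun p => [ffun d => match d with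
  | One => yc false (X p false)
  | X u s => (~~ s && (u - p == slope_rep (slope (u - p)))%R)%:R
             * V (- (u + p)) (slope (u - p))
  | E w m => ((p == 0) && (w == 0))%:R * Z m
  | G _ => 0 end] : A].
exists x; apply/ffunP => s; apply/ffunP => d; rewrite dual_relE.
under eq_bigr do rewrite mul_mon.
rewrite -[RHS]/(yc s d); case: d => [|q t|w m|l].
- by rewrite yOne big1 // => p _; rewrite quot_low.
- rewrite yX (@sum_only1 _ _ _ q) => [|p pq].
    rewrite quot_XX !ffunE; have -> // : (X q s == X q t) = (s == t).
    by apply/eqP/idP => [[->]|/eqP->].
  rewrite quot_XX.
  by case: (_ =P X q t) pq => [[-> _]|_ _]; rewrite ?eqxx ?mul0r.
- rewrite yE.
  have sm3 : (s + m <= 3)%N by case: s; case: m => [[|[|[]]]].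
  have upE p : - (p + w) - p = p - w.
    have /eqP := plane_mul3 p; rewrite addr_eq0 => /eqP pp.
    by rewrite opprD addrAC -opprD pp opprK.
  have wE p : - (- (p + w) + p) = w by rewrite opprD opprK -addrA addrC subrK.
  have slE p : slope (p - w) = slope (w - p) by rewrite -slopeN opprB.
  rewrite (@sum_only1 _ _ _ (w + slope_rep (s + m))) => [|p pN].
    set p := w + _; have pw : p - w = slope_rep (s + m) by rewrite addrC addKr.
    rewrite quot_XE !ffunE upE wE -slE pw slope_repK ?eqxx /=; last by lia.
    by rewrite mul0r mulr0 addr0 !mul1r.
  rewrite quot_XE !ffunE upE wE slE /= mul0r mulr0 addr0.
  have [->|_] := eqVneq (slope _) (s + m)%N; last by rewrite mul0r.
  have [pw|_] := eqVneq (p - w) (slope_rep _); last by rewrite mul0r mulr0.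
  by rewrite -pw addrC subrK eqxx in pN.
- rewrite yG (@sum_only1 _ _ _ 0) => [|p /negPf p0].
    by rewrite quot_XG !ffunE !eqxx inord_add mul1r.
  by rewrite quot_XG !ffunE p0 mul0r.
Qed.

End Presentation.

(** * Extending maps from the syzygy module *)

Section Extension.
Variable K : fieldType.
Local Notation A := (alg K).
Local Notation mon := (mon K).
Local Notation P0 := {ffun bool -> A^o}.
Local Notation P1 := {ffun plane -> A^o}.

(** The values on basis vectors of a map killing the kernel of [dual_rel]; [c_compat] records this
    for relations between two multiples of generators. *)
Variable c : plane -> A.
Hypothesis c_compat : forall r r' p p',
  (forall s, r * mon (X p s) = r' * mon (X p' s)) -> r * c p = r' * c p'.

Lemma compat0 r p : (forall s, r * mon (X p s) = 0) -> r * c p = 0.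
Proof.
move=> r0; rewrite (c_compat (r' := 0) (p' := p)) ?mul0r // => s.
by rewrite r0 mul0r.
Qed.

Lemma compat_One p : c p One = 0.
Proof.
have /ffunP/(_ (G false)) : mon (G false) * c p = 0.
  apply: compat0 => s; apply/ffunP => d.
  by rewrite mon_mul_mon ffunE; case: d.
by rewrite mul_mon quot_same // eqxx mul1r ffunE.
Qed.

Lemma coef_mulE p q (s : bool) :
  (mon (E q (inord s)) * c p) (G false) = c p (X q s).
Proof.
rewrite mul_mon quot_EG inordK; last by case: s.
by case: s; rewrite /= !mul0r !mul1r ?addr0 ?add0r.
Qed.

(** [E q _] kills the p-th generator for q != p, and its product with the q-th one is the same for
    all q. *)
Lemma compat_X p q s : c p (X q s) = (p == q)%:R * c 0 (X 0 s).
Proof.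
have [<-|pq] := eqVneq p q; rewrite (mul1r, mul0r) -[LHS]coef_mulE.
  have -> : mon (E p (inord s)) * c p = mon (E 0 (inord s)) * c 0.
    apply: c_compat => t; apply/ffunP => d.
    by rewrite !mon_mul_mon /=; case: d => [|? ?|? ?|l]; rewrite ?eqxx.
  exact: coef_mulE.
have -> : mon (E q (inord s)) * c p = 0 by
  apply: compat0 => t; apply/ffunP => d;
  rewrite mon_mul_mon ffunE /=; case: d => [|? ?|? ?|l]; rewrite ?(negPf pq).
by rewrite ffunE.
Qed.

(* [mon (X q t)] times the p-th relation depends only on the point p + q and on
   the difference [slope (p - q) - t]; [compat_E] and [compat_E_eq0] transport
   this to the values [c]. *)
Lemma compat_E p q p' q' (t t' l : bool) :
  p + q = p' + q' -> (slope (p - q)%R + t' = slope (p' - q')%R + t)%N ->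
  c p (E q (inord (t + l))) = c p' (E q' (inord (t' + l))).
Proof.
move=> pq sl.
rewrite -(quot_XG (c p)) -(quot_XG (c p')) -!mul_mon.
rewrite (c_compat (r' := mon (X q' t')) (p' := p')) // => s.
apply/ffunP => d; rewrite !mon_mul_mon; case: d => //= w m.
rewrite [q + p]addrC pq [p' + q']addrC; congr (_ && _)%:R.
rewrite -[q - p]opprB -[q' - p']opprB !slopeN.
move: (slope (p - q)) (slope (p' - q')) sl => a b.
by case: t; case: t' => sl; apply/eqP/eqP; lia.
Qed.

Lemma compat_E_eq0 p q (t l : bool) :
  slope (p - q) = (if t then 0 else 4)%N -> c p (E q (inord (t + l))) = 0.
Proof.
move=> sl; rewrite -(quot_XG (c p)) -mul_mon compat0 ?ffunE // => s.
apply/ffunP => d; rewrite mon_mul_mon ffunE; case: d => //= w m.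
rewrite -[q - p]opprB slopeN sl; case: eqP => //= _.
(* A nonzero product would need 0 = 1 + s + m or 4 = s + m, but s + m is at most 3. *)
by case: eqP => // E; case: t s m E {sl} => -[] [[|[|[]]]].
Qed.

(** The points r + d, r - d and r form the line of class k through r, so by [compat_E] this is the
    value of [c p (E q 0)] for all p, q of class k with third point r. *)
Definition rep_coef r k : K :=
  c (r + slope_rep k) (E (r - slope_rep k) (inord 0)).

Lemma rep_sum r k : r + slope_rep k + (r - slope_rep k) = - r.
Proof.
apply/eqP; rewrite -subr_eq0 opprK -(plane_mul3 r) addrACA subrr addr0.
by [].
Qed.

Lemma rep_slope r k : (k <= 4)%N ->
  slope (r + slope_rep k - (r - slope_rep k)) = k.
Proof.
move=> k4; rewrite opprB addrC addrA subrK.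
have /eqP := plane_mul3 (slope_rep k); rewrite addr_eq0 => /eqP->.
by rewrite slopeN slope_repK.
Qed.

Lemma compat_E0 p q k : (k <= 4)%N -> slope (p - q) = k ->
  c p (E q (inord 0)) = rep_coef (- (p + q)) k.
Proof.
move=> k4 sl; apply: (@compat_E _ _ _ _ false false false).
  by rewrite rep_sum opprK.
by rewrite rep_slope ?sl.
Qed.

(** Moving from position 1 to position 0 lowers the class by one; classes 0 and 4 fall under
    [compat_E_eq0]. *)
Lemma compat_E1 p q : c p (E q (inord 1)) =
  if (slope (p - q)%R \in [:: 1; 2; 3])%N
  then rep_coef (- (p + q)) (slope (p - q)).-1 else 0.
Proof.
have := slope_le4 (p - q); case sl: (slope (p - q)) => [|[|[|[|[|k]]]]] //= _;
  try by rewrite (@compat_E _ _ (- (p + q) + slope_rep (slope (p - q)).-1)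
      (- (p + q) - slope_rep (slope (p - q)).-1) true false false)
    ?rep_sum ?opprK ?rep_slope ?sl.
- exact: (@compat_E_eq0 _ _ true false).
- exact: (@compat_E_eq0 _ _ false true).
Qed.

Lemma compat_E2 p q : c p (E q (inord 2)) =
  if (slope (p - q)%R \in [:: 2; 3; 4])%N
  then rep_coef (- (p + q)) (slope (p - q)).-2 else 0.
Proof.
have := slope_le4 (p - q); case sl: (slope (p - q)) => [|k] k4.
  exact: (@compat_E_eq0 _ _ true true).
rewrite (@compat_E _ _ (- (p + q) + slope_rep k)
      (- (p + q) - slope_rep k) true false true)
    ?rep_sum ?opprK ?rep_slope ?sl ?addn1 ?addn0 ?(ltnW k4) //.
by rewrite compat_E1 rep_sum opprK rep_slope ?(ltnW k4) //.
Qed.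

(** Class 4 vanishes by [compat_E_eq0]; class 3 in position 0 equals class 4 in position 1, also
    0. *)
Lemma rep_coef_top r k : (k == 3)%N || (k == 4)%N -> rep_coef r k = 0.
Proof.
have v4 p q : slope (p - q) = 4 -> c p (E q (inord 0)) = 0.
  by move=> sl; apply: (@compat_E_eq0 _ _ false false).
case/orP => /eqP->; rewrite /rep_coef; last by apply: v4; rewrite rep_slope.
rewrite (@compat_E _ _ (r + slope_rep 4) (r - slope_rep 4) false true false)
  ?rep_sum ?rep_slope //.
by rewrite compat_E1 rep_slope.
Qed.

(** The images of the two basis vectors under the extension. Of [rep_coef u k] only k = 0, 1, 2
    survive: the first two go here, the last into [extend_true]. The top coefficients [c p (G l)]
    are absorbed by [E p l]. *)
Definition extend_false : A := [ffun d => match d with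
  | One => c 0 (X 0 false)
  | X u s => rep_coef u s
  | E p m => if (m < 2)%N then c p (G (m == 1%N :> nat)) else 0
  | G _ => 0 end].
Definition extend_true : A := [ffun d => match d with
  | One => c 0 (X 0 true)
  | X u s => if s then rep_coef u 2 else 0
  | _ => 0 end].

Lemma compat_extend p :
  c p = mon (X p false) * extend_false + mon (X p true) * extend_true.
Proof.
apply/ffunP => d; rewrite addE !mul_mon.
case: d => [|q s|q m|l].
- by rewrite compat_One !quot_low // addr0.
- rewrite compat_X !quot_XX [extend_false _]ffunE [extend_true _]ffunE.
  have XE t : (X p t == X q s) = (p == q) && (t == s).
    by apply/eqP/andP => [[-> ->]|[/eqP-> /eqP->]].
  rewrite !XE {XE}; case: (p == q); case: s;
  by rewrite /= ?mul0r ?mul1r ?addr0 ?add0r.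
(* For p - q of class k, both sides are [rep_coef] at -(p + q) and k - m, and vanish unless k - m is
   0, 1 or 2. *)
- rewrite !quot_XE ![extend_false _]ffunE ![extend_true _]ffunE mulr0 add0r.
  rewrite -[q - p]opprB slopeN -(inord_val m).
  have := slope_le4 (p - q).
  case: m => [[|[|[|//]]] mlt]; rewrite inordK //= ?compat_E1 ?compat_E2.
  + have [v3 v4] : (forall r, rep_coef r 3 = 0) * (forall r, rep_coef r 4 = 0).
      by split=> r; apply: rep_coef_top.
    rewrite (compat_E0 (slope_le4 _) erefl).
    case: (slope _) => [|[|[|[|[|//]]]]] _ /=;
    by rewrite ?v3 ?v4 ?mul0r ?mul1r ?addr0 ?add0r.
  + case: (slope _) => [|[|[|[|[|//]]]]] _ /=;
    by rewrite ?mul0r ?mul1r ?addr0 ?add0r.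
  + case: (slope _) => [|[|[|[|[|//]]]]] _ /=;
    by rewrite ?mul0r ?mul1r ?addr0 ?add0r.
- rewrite !quot_XG [extend_false _]ffunE [extend_true _]ffunE addr0.
  by case: l; rewrite inordK.
Qed.

End Extension.

(** * Vanishing of Ext^1 *)

Lemma factors_through_dual_rel (K : fieldType)
    (phi : {linear {ffun plane -> (alg K)^o} -> (alg K)^o}) :
  (forall u, dual_rel K u = 0 -> phi u = 0) ->
  exists psi : {linear {ffun bool -> (alg K)^o} -> (alg K)^o},
    forall u, phi u = psi (dual_rel K u).
Proof.
move=> phi0; pose c p : alg K := phi (free_basis (alg K) p).
have c_compat r r' p p' :
  (forall s, r * mon K (X p s) = r' * mon K (X p' s)) -> r * c p = r' * c p'.
  move=> rr'; apply/eqP; rewrite -subr_eq0.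
  have -> : r * c p - r' * c p' =
      phi (r *: free_basis (alg K) p - r' *: free_basis (alg K) p').
    by rewrite linearB !linearZ.
  apply/eqP/phi0; rewrite linearB; apply/eqP; rewrite subr_eq0; apply/eqP.
  by apply/ffunP => s; rewrite [LHS]dual_rel_basis rr' [RHS]dual_rel_basis.
pose w s : alg K := if s then extend_true c else extend_false c.
pose psi : {linear {ffun bool -> (alg K)^o} -> (alg K)^o} :=
  free_map (w : bool -> (alg K)^o).
have psiE p :
  phi (free_basis (alg K) p) = psi (dual_rel K (free_basis (alg K) p)).
  have relE s : (dual_rel K (free_basis (alg K) p) s : alg K) = mon K (X p s).
    by rewrite -[free_basis (alg K) p]scale1r dual_rel_basis mul1r.
  rewrite /psi /= /free_map big_bool !relE.
  exact: etrans (compat_extend c_compat p) (addrC _ _).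
exists psi => u.
rewrite [LHS]linear_freeE [dual_rel K u]linear_freeE linear_sum.
by apply: eq_bigr => p _; rewrite linearZ psiE.
Qed.

Lemma alg_Ext1_eq0 (K : fieldType) : Ext1_eq0 (dual (alg K)) (alg K)^o.
Proof.
have [n [v v_exact]] := free_kernel_presented (dual_rel K).
exists {ffun 'I_n -> (alg K)^o}, {ffun plane -> (alg K)^o},
  {ffun bool -> (alg K)^o}.
exists (free_map v), (dual_rel K), (dual_cover K); split=> [|phi phi_v].
  split; first by split; apply: free_projective.
  split=> //; first exact: dual_cover_surj.
  by move=> y; split=> [/dual_cover_kernel|[x <-]]; last apply: dual_cover_rel.
apply: factors_through_dual_rel => u /v_exact[x <-]; exact: phi_v.
Qed.

Theorem theorem0p1 :
  exists R : comFDAlgType rat,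
    [/\ local_ring R, ~ gorenstein R & Ext1_eq0 (dual R) R^o].
Proof.
exists (alg rat); split.
- exact: alg_local.
- exact: alg_not_gorenstein.
- exact: alg_Ext1_eq0.
Qed.
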